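(* Let $D$ be a distortion function and let $Q$ be the probability measure on $\mathcal{B}((0,1))$ corresponding to $D$. The following are equivalent: (a) $D$ is convex. (b) There exists a spectral function $s$ such that $Q=\int s(u)\,d\lambda(u)$, i.e. $Q$ has density $s$ with respect to $\lambda$. (c) $\varrho_Q$ is a spectral risk measure. In this case, every spectral function $s$ representing $Q$ (i.e. with $Q=\int s(u)\,d\lambda(u)$) satisfies $s=D'$ almost everywhere with respect to $\lambda$, where $D'$ is the derivative of $D$.
   Context: ''Increasing'' and ''positive'' are meant in the weak sense. $(\Omega,\mathcal{F},P)$ is a fixed probability space and $\mathcal{L}^0$ is the set of all real random variables on it. $\lambda$ denotes Lebesgue measure on $\mathcal{B}((0,1))$. For $X\in\mathcal{L}^0$, $F_X(x):=P[\{X\le x\}]$ and $F_X^\leftarrow:(0,1)\to\mathbb{R}$, $F_X^\leftarrow(u):=\inf\{x\in\mathbb{R}\mid F_X(x)\ge u\}$, is the (lower) quantile function. A distortion function is an increasing, right-continuous function $D:[0,1]\to[0,1]$ with $D(0)=0$ and $\sup_{u\in(0,1)}D(u)=1$ (hence $D(1)=1$). The probability measure $Q$ on $\mathcal{B}((0,1))$ corresponding to $D$ is the unique one with $Q[(0,u]]=D(u)$ for all $u\in(0,1)$. $\mathcal{L}_Q:=\{X\in\mathcal{L}^0\mid\int_{(0,1)}(F_X^\leftarrow(u))^+\,dQ(u)<\infty\}$, and the quantile risk measure $\varrho_Q:\mathcal{L}_Q\to[-\infty,\infty)$ is $\varrho_Q[X]:=\int_{(0,1)}F_X^\leftarrow(u)\,dQ(u)$.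 A spectral function is an increasing map $s:(0,1)\to[0,\infty)$ with $\int_{(0,1)}s(u)\,d\lambda(u)=1$. The quantile risk measure $\varrho_Q$ is called a spectral risk measure if there exists a spectral function $s$ such that $Q=\int s(u)\,d\lambda(u)$, i.e. $Q[B]=\int_B s(u)\,d\lambda(u)$ for all $B\in\mathcal{B}((0,1))$. *)

(* Defs.v *)
From HB Require Import structures.
From mathcomp Require Export all_boot all_order all_algebra.
From mathcomp Require Export all_classical all_reals all_analysis.
Export Order.TTheory GRing.Theory Num.Theory.
Export numFieldNormedType.Exports.

Set Implicit Arguments.
Unset Strict Implicit.
Unset Printing Implicit Defensive.

Local Open Scope classical_set_scope.
Local Open Scope ring_scope.

(* Functions on [0,1] or (0,1) are represented by functions R -> R of which
   only the restriction to that interval is ever used.  Probability measures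
   on B((0,1)) are represented by Borel probability measures on R that give
   mass 1 to `]0, 1[. *)

(* The values on [0,1] lie in [0,1], so this sup is that of a nonempty bounded
   set; D 1 = 1 follows. *)
Definition distortion_function (R : realType) (D : R -> R) : Prop :=
  [/\ {in `[0, 1], forall u, D u \in `[0, 1]},
      {in `[0, 1] &, {homo D : u v / u <= v}},
      {in `[0, 1[, forall u, D @ at_right u --> D u},
      D 0 = 0 &
      sup (D @` `]0, 1[%classic) = 1].

Definition corresponding_measure (R : realType) (D : R -> R)
    (Q : probability (measurableTypeR R) R) : Prop :=
  Q `]0%R, 1%R[%classic = 1%E /\
  {in `]0, 1[, forall u : R, Q `]0%R, u]%classic = (D u)%:E}.

(* For 0 < u < 1 the set is nonempty and bounded below, so the infimum is the
   genuine one. *)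
Definition lower_quantile d (T : measurableType d) (R : realType)
    (P : probability T R) (X : {RV P >-> R}) (u : R) : R :=
  inf [set x : R | (u%:E <= cdf X x)%E].

Definition quantile_domain d (T : measurableType d) (R : realType)
    (P : probability T R) (Q : probability (measurableTypeR R) R) :
    set {RV P >-> R} :=
  [set X | (\int[Q]_(u in `]0%R, 1%R[%classic) (EFin \o lower_quantile X)^\+ u
            < +oo)%E].
Arguments quantile_domain {d T R} P Q _.

(* On quantile_domain the positive part has finite integral, so the value is
   different from +oo. *)
Definition quantile_risk_measure d (T : measurableType d) (R : realType)
    (P : probability T R) (Q : probability (measurableTypeR R) R)
    (X : quantile_domain P Q) : \bar R :=
  (\int[Q]_(u in `]0%R, 1%R[%classic) (lower_quantile (val X) u)%:E)%E.
Arguments quantile_risk_measure {d T R} P Q X.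

Definition spectral_function (R : realType) (s : R -> R) : Prop :=
  [/\ {in `]0, 1[, forall u, 0 <= s u},
      {in `]0, 1[ &, {homo s : u v / u <= v}} &
      (\int[lebesgue_measure]_(u in `]0%R, 1%R[%classic) (s u)%:E = 1)%E].

Definition has_density (R : realType)
    (Q : probability (measurableTypeR R) R) (s : R -> R) : Prop :=
  forall B : set (measurableTypeR R), measurable B -> B `<=` `]0%R, 1%R[%classic ->
    Q B = (\int[lebesgue_measure]_(u in B) (s u)%:E)%E.

(* The measure Q is part of the data of a quantile risk measure (here it is
   carried by the type of the domain of rho): on a probability space with few
   random variables, different Q may induce the same functional. *)
Definition spectral_risk_measure d (T : measurableType d) (R : realType)
    (P : probability T R) (Q : probability (measurableTypeR R) R)
    (rho : quantile_domain P Q -> \bar R) : Prop :=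
  rho = quantile_risk_measure P Q /\
  exists2 s : R -> R, spectral_function s & has_density Q s.

(* Main.v *)
(* Convexity gives a density: the right slope s of D satisfies
   s x <= (D y - D x) / (y - x) <= s y for x < y, so the increments over
   [x, y] of D and of the integral of s differ by at most
   (s y - s x) * (y - x).  Bisecting k times divides this bound by 2 ^ k, so
   D is the integral of s, and Q and s dlambda agree on the intervals ]0, u],
   hence on all Borel subsets of ]0, 1[.
   Conversely, if Q has the increasing density s, then
   D x - D c >= s c * (x - c), i.e. D has a supporting line at every c in
   ]0, 1[ and is convex.  The identity s = D' almost everywhere is Lebesgue's
   differentiation theorem. *)

From HB Require Import structures.
Require Import Defs.
From mathcomp Require Import ring lra measurable_realfun.

Set Implicit Arguments.
Unset Strict Implicit.
Unset Printing Implicit Defensive.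

Local Open Scope classical_set_scope.
Local Open Scope ring_scope.

(** * Increments bounded by oscillation times length; measurability of monotone functions *)

Section real_functions.
Context {R : realType}.
Implicit Types (f g h : R -> R) (a b c u x y : R).

(** At a midpoint both lengths are halved while the increments of [f] telescope, so each bisection
    halves the bound on [h y - h x]. No continuity of [f] enters. *)
Lemma eq_of_slope_oscillation h f a b : a <= b ->
  (forall x y, a <= x -> x <= y -> y <= b ->
    `|h y - h x| <= (f y - f x) * (y - x)) ->
  h a = h b.
Proof.
move=> ab hf.
have {}hf k : forall x y, a <= x -> x <= y -> y <= b ->
    `|h y - h x| <= (f y - f x) * (y - x) / 2 ^+ k.
  elim: k => [|k IH] x y ax xy yb; first by rewrite expr0 divr1 hf.
  pose m := (x + y) / 2.
  have xm : x <= m by rewrite /m; lra.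
  have my : m <= y by rewrite /m; lra.
  have -> : h y - h x = (h y - h m) + (h m - h x) by ring.
  rewrite (le_trans (ler_normD _ _))//.
  have h1 := IH m y (le_trans ax xm) my yb.
  have h2 := IH x m ax xm (le_trans my yb).
  have -> : (f y - f x) * (y - x) / 2 ^+ k.+1 =
      (f y - f m) * (y - m) / 2 ^+ k + (f m - f x) * (m - x) / 2 ^+ k.
    by rewrite exprS /m; field; rewrite expf_neq0.
  exact: lerD.
apply/esym/eqP; rewrite -subr_eq0 -normr_le0 leNgt; apply/negP => e0.
(* The quotient is less than [k], which is less than [2 ^ k]; the [k]-th bound then contradicts
   [h b != h a]. *)
pose k := (Num.truncn ((f b - f a) * (b - a) / `|h b - h a|)).+1.
have := hf k a b (lexx _) ab (lexx _).
rewrite ler_pdivlMr ?exprn_gt0// mulrC -ler_pdivlMr// leNgt => /negP; apply.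
rewrite (lt_le_trans (truncnS_gt _))// -natrX ler_nat ltnW//.
exact: ltn_expl.
Qed.

(** The preimage within [i] of a ray [[r, +oo[] is order-convex, hence an interval, and these rays
    generate the Borel sets. *)
Lemma monotone_measurable_fun (i : interval R) f :
  {in i &, {homo f : x y / x <= y}} -> measurable_fun [set` i] f.
Proof.
move=> fi mD; apply: (measurability (@RGenCInfty.G R)) mD => [|/= _ [_] [r] -> <-].
  exact: RGenCInfty.measurableE.
apply: is_interval_measurable => s t/= [si] + [ti] _.
rewrite !in_itv/= !andbT => fs u /andP[su ut].
have ui : u \in i by apply: (@interval_is_interval _ i s t); rewrite // su ut.
by split => //; rewrite in_itv/= andbT (le_trans fs)// fi.
Qed.

End real_functions.

(** * Measures given by densities; uniqueness of measures on an open interval *)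

Section measures.
Context {R : realType}.
Implicit Types (f : R -> R) (a b c u : R).

(** Packages the indefinite integral as a measure, so that uniqueness theorems for measures apply to
    it. *)
Lemma density_measure d (T : measurableType d) (mu : {measure set T -> \bar R})
    (f : T -> \bar R) :
  measurable_fun setT f -> (forall x, 0 <= f x)%E ->
  exists nu : {measure set T -> \bar R},
    forall A, measurable A -> nu A = (\int[mu]_(x in A) f x)%E.
Proof.
move=> mf f0.
pose nu (A : set T) := (\int[mu]_(x in A) f x)%E.
have nu0 : nu set0 = 0%E by exact: integral_set0.
have nu_ge0 A : (0 <= nu A)%E by exact: integral_ge0.
have nuU : semi_sigma_additive nu.
  move=> /= A mA tA mUA; rewrite /nu ge0_integral_bigcup//; last first.
    exact: measurable_funS mf.
  by apply: is_cvg_ereal_nneg_natsum_cond => n _ _; exact: nu_ge0.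
pose m := isMeasure.Build _ _ _ nu nu0 nu_ge0 nuU.
pose numeas : {measure set T -> \bar R} := HB.pack nu m.
by exists numeas.
Qed.

(** The restrictions to []a, b[] are compared on the rays []c, +oo[], which are stable under
    intersection and generate the Borel sets. *)
Lemma measure_itvoo_unique (m1 m2 : {measure set (measurableTypeR R) -> \bar R})
    a b :
  (m1 `]a, b[%classic < +oo)%E ->
  {in `]a, b[, forall u : R, m1 `]a, u]%classic = m2 `]a, u]%classic} ->
  forall B : set R, measurable B -> B `<=` `]a, b[ -> m1 B = m2 B.
Proof.
move=> m1fin m12.
have mab : measurable (`]a, b[%classic : set (measurableTypeR R)) by [].
(* Continuity from below along []a, b - 1 / (n + 1)]]; for small [n] this interval may be empty. *)
have m12ab : m1 `]a, b[%classic = m2 `]a, b[%classic.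
  pose F n : set (measurableTypeR R) := `]a, b - n.+1%:R^-1]%classic.
  have FE : `]a, b[%classic = \bigcup_n F n by rewrite itv_bnd_open_bigcup.
  have mF n : measurable (F n) by exact: measurable_itv.
  have ndF : nondecreasing_seq F.
    move=> m n mn; apply/subsetPset => x; rewrite /F/= !in_itv/= => /andP[->/=].
    move=> /le_trans; apply; rewrite lerD2l lerN2 lef_pV2 ?posrE ?ltr0n//.
    by rewrite ler_nat ltnS.
  have m1F : (m1 \o F) n @[n --> \oo] --> m1 `]a, b[%classic.
    by rewrite FE; apply: nondecreasing_cvg_mu => //; exact: bigcup_measurable.
  have m2F : (m2 \o F) n @[n --> \oo] --> m2 `]a, b[%classic.
    by rewrite FE; apply: nondecreasing_cvg_mu => //; exact: bigcup_measurable.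
  suff E : m1 \o F = m2 \o F.
    by rewrite E in m1F; apply: (cvg_unique _ m1F m2F).
  apply/funext => n /=; have [ab|ab] := ltP a (b - n.+1%:R^-1)%R.
    by apply: m12; rewrite in_itv/= ab/= gtrBl.
  by rewrite /F set_itv_ge ?measure0// bnd_simp -leNgt.
have m12c c : m1 (`]c, +oo[ `&` `]a, b[) = m2 (`]c, +oo[ `&` `]a, b[).
  have [ca|ac] := leP c a.
    suff -> : `]c, +oo[ `&` `]a, b[ = `]a, b[%classic by [].
    by apply: setIidr => x/=; rewrite !in_itv/= andbT => /andP[/(le_lt_trans ca)].
  have [bc|cb] := leP b c.
    suff -> : `]c, +oo[ `&` `]a, b[ = set0 by rewrite !measure0.
    rewrite -subset0 => x/= []; rewrite !in_itv/= andbT => cx /andP[_ xb].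
    by have := lt_trans cx xb; rewrite ltNge bc.
  (* Passing to the complement reduces to the known intervals []a, c]]; the subtraction is
     legitimate because both measures of []a, b[] are finite. *)
  have -> : `]c, +oo[ `&` `]a, b[ = `]a, b[%classic `\` `]a, c].
    apply/seteqP; split => x/=; rewrite !in_itv/= andbT.
      by move=> [cx ->]; rewrite (lt_trans ac cx)/= leNgt cx.
    by move=> [/andP[-> ->]] /=; rewrite leNgt => /negP/negPn.
  have ac_ab : `]a, b[ `&` `]a, c] = `]a, c]%classic :> set R.
    apply: setIidr => x/=; rewrite !in_itv/= => /andP[-> xc].
    by rewrite (le_lt_trans xc).
  have m2fin : (m2 `]a, b[%classic < +oo)%E by rewrite -m12ab.
  rewrite !measureD// ac_ab.
  by congr (_ - _)%E; [exact: m12ab|apply: m12; rewrite in_itv/= ac].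
move=> B mB Bab.
have -> : B = B `&` `]a, b[ by rewrite setIidl.
have mB' : measurable (B : set (measurableTypeR R)) := mB.
have := @measure_unique _ R (measurableTypeR R) (@RGenOInfty.G R)
  (fun n => `](- n%:R)%R, +oo[%classic) _ _ _ _ (mrestr m1 mab) (mrestr m2 mab) _ _ B mB'.
apply.
- exact: RGenOInfty.measurableE.
- move=> _ _ [x ->] [y ->]; exists (Num.max x y).
  by apply/seteqP; split => z/=; rewrite !in_itv/= !andbT gt_max;
    [move=> [-> ->]|move=> /andP].
- by move=> n; eexists.
- rewrite -subTset => x _; exists (Num.truncn `|x|).+1 => //=.
  rewrite in_itv/= andbT ltrNl.
  by rewrite (le_lt_trans (ler_norm _))// normrN truncnS_gt.
- by move=> _ [x ->]; exact: m12c.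
- move=> n; apply: le_lt_trans m1fin; rewrite /= /mrestr.
  apply: le_measure; rewrite ?inE//; first exact: measurableI.
Qed.

Lemma ge0_integral_cst_le (A : set R) f c : measurable A ->
  measurable_fun A f -> (forall x, A x -> (0 <= c <= f x)%R) ->
  (c%:E * lebesgue_measure A <= \int[lebesgue_measure]_(x in A) (f x)%:E)%E.
Proof.
move=> mA mf cf; rewrite -integral_cst//; apply: ge0_le_integral => //.
- by move=> x /cf/andP[c0 _]; rewrite lee_fin.
- exact/measurable_EFinP.
- by move=> x /cf/andP[_ c1]; rewrite lee_fin.
Qed.

Lemma ge0_integral_le_cst (A : set R) f c : measurable A ->
  measurable_fun A f -> (forall x, A x -> (0 <= f x <= c)%R) ->
  (\int[lebesgue_measure]_(x in A) (f x)%:E <= c%:E * lebesgue_measure A)%E.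
Proof.
move=> mA mf cf; rewrite -integral_cst//; apply: ge0_le_integral => //.
- by move=> x /cf/andP[c0 _]; rewrite lee_fin.
- exact/measurable_EFinP.
- by move=> x /cf/andP[_ c1]; rewrite lee_fin.
Qed.

End measures.

(** * Chord slopes, right slopes and supporting lines *)

Section convex.
Context {R : realType}.
Implicit Types (D : R -> R) (a b u v x y : R).

(** [y] is the convex combination of [x] and [v] with weight [(v - y) / (v - x)] on [x]; clearing
    denominators in the convexity inequality gives the claim. *)
Lemma convex_slope_le D a b x y v :
  convex_function (`[a, b]%classic : set R) D ->
  a <= x -> x < y -> y < v -> v <= b ->
  (D y - D x) / (y - x) <= (D v - D y) / (v - y).
Proof.
move=> cD ax xy yv vb.
have xv : 0 < v - x by rewrite subr_gt0 (lt_trans xy).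
have t0 : 0 <= (v - y) / (v - x) by rewrite divr_ge0 ?subr_ge0 ?ltW ?(lt_trans xy).
have t1 : (v - y) / (v - x) <= 1.
  by rewrite ler_pdivrMr// mul1r lerD2l lerN2 ltW.
have xab : x \in (`[a, b]%classic : set R).
  by rewrite inE/= in_itv/= ax (le_trans _ vb)// ltW// (lt_trans xy).
have vab : v \in (`[a, b]%classic : set R).
  by rewrite inE/= in_itv/= vb (le_trans ax)// ltW// (lt_trans xy).
have := cD (Itv01 t0 t1) x v xab vab.
have -> : conv (Itv01 t0 t1) (x : convex_lmodType R^o) v = y.
  change ((v - y) / (v - x) * x + (1 - (v - y) / (v - x)) * v = y).
  by field; rewrite gt_eqF.
move=> Dy0; have Dy : D y <=
    (v - y) / (v - x) * D x + (1 - (v - y) / (v - x)) * D v := Dy0.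
rewrite ler_pdivrMr ?subr_gt0// mulrAC ler_pdivlMr ?subr_gt0//.
have := ler_wpM2r (ltW xv) Dy.
have -> : ((v - y) / (v - x) * D x + (1 - (v - y) / (v - x)) * D v) * (v - x) =
   (v - y) * D x + (y - x) * D v by field; rewrite gt_eqF.
lra.
Qed.

(** For convex increasing [D] and [u < b] this is the right derivative at [u]. As an infimum it is
    compared with chords without any passage to the limit. At [u = b] the set is empty. *)
Definition right_slope D b u := inf [set (D v - D u) / (v - u) | v in `]u, b]].

Section right_slope.
Variables (D : R -> R) (a b : R).
Hypothesis D_nd : {in `[a, b] &, {homo D : u v / u <= v}}.

Lemma right_slope_ge0 u : a <= u -> u < b -> 0 <= right_slope D b u.
Proof.
move=> au ub; apply: lb_le_inf => [|_ [v /= + <-]].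
  by exists ((D b - D u) / (b - u)), b => //=; rewrite in_itv/= ub lexx.
rewrite in_itv/= => /andP[uv vb]; rewrite divr_ge0 ?subr_ge0 ?(ltW uv)//.
by apply: D_nd; rewrite ?in_itv/= ?au ?(ltW uv) ?vb ?(ltW ub) ?(le_trans au (ltW uv)).
Qed.

Lemma right_slope_le u v : a <= u -> u < v -> v <= b ->
  right_slope D b u <= (D v - D u) / (v - u).
Proof.
move=> au uv vb; apply: ge_inf; last by exists v => //=; rewrite in_itv/= uv.
(* Since [D] is increasing, [0] bounds all the chord slopes from below, so the infimum is
   genuine. *)
exists 0 => _ [w /= + <-].
rewrite in_itv/= => /andP[uw wb]; rewrite divr_ge0 ?subr_ge0 ?(ltW uw)//.
have ub := lt_le_trans uw wb.
by apply: D_nd; rewrite ?in_itv/= ?au ?(ltW uw) ?wb ?(ltW ub) ?(le_trans au (ltW uw)).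
Qed.

Hypothesis cD : convex_function (`[a, b]%classic : set R) D.

Lemma le_right_slope u v : a <= u -> u < v -> v < b ->
  (D v - D u) / (v - u) <= right_slope D b v.
Proof.
move=> au uv vb; apply: lb_le_inf => [|_ [w /= + <-]].
  by exists ((D b - D v) / (b - v)), b => //=; rewrite in_itv/= vb lexx.
by rewrite in_itv/= => /andP[vw wb]; exact: convex_slope_le cD _ _ _ _.
Qed.

Lemma right_slope_homo : {in `[a, b[ &, {homo right_slope D b : u v / u <= v}}.
Proof.
move=> u v; rewrite !in_itv/= => /andP[au ub] /andP[av vb].
rewrite le_eqVlt => /predU1P[->//|uv].
exact: le_trans (right_slope_le au uv (ltW vb)) (le_right_slope au uv vb).
Qed.

End right_slope.

(** In the average of the support inequalities at [x] and [y], weighted as in [c], the linear terms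
    cancel. Supporting lines are asked for only at interior points, where a density on the open
    interval provides them. *)
Lemma convex_of_support D a b (s : R -> R) :
  (forall c x, a < c < b -> a <= x <= b -> s c * (x - c) <= D x - D c) ->
  convex_function (`[a, b]%classic : set R) D.
Proof.
move=> Ds t x y; rewrite !inE/= !in_itv/= => xab yab.
pose c : R := conv t x y.
have cE : c = t%:num * x + (1 - t%:num) * y by [].
change (D c <= t%:num * D x + (1 - t%:num) * D y).
have : 0 <= t%:num by [].
have : t%:num <= 1 by [].
set p : R := t%:num in cE *; move=> p1 p0.
(* The degenerate cases are settled first, because only in them can [c] be an endpoint. *)
have [p00|pn0] := eqVneq p 0; first by rewrite cE p00 !mul0r !add0r subr0 !mul1r.
have [p11|pn1] := eqVneq p 1; first by rewrite cE p11 subrr !mul0r !addr0 !mul1r.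
have {}p0 : 0 < p by rewrite lt_def pn0.
have {}p1 : p < 1 by rewrite lt_neqAle pn1.
have [xy|xy] := eqVneq x y.
  have -> : c = y by rewrite cE xy; ring.
  by rewrite le_eqVlt xy; apply/orP/or_introl/eqP; ring.
have cab : a < c < b.
  rewrite cE; move: xy xab yab; rewrite neq_lt => /orP[xy|xy] /andP[ax xb] /andP[ay yb]; apply/andP; split; nra.
have h1 := Ds c x cab xab; have h2 := Ds c y cab yab.
have := lerD (ler_wpM2l (ltW p0) h1) (ler_wpM2l (ltW (etrans (subr_gt0 _ _) p1)) h2).
rewrite cE; nra.
Qed.

End convex.

(** * Integrals of monotone functions *)

Section integrals.
Context {R : realType}.
Implicit Types (D G f s : R -> R) (a b c u x y : R).

Lemma lebesgue_measure_itvoc x y : x <= y ->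
  lebesgue_measure (`]x, y]%classic : set R) = (y - x)%:E.
Proof.
rewrite le_eqVlt lebesgue_measure_itv/= lte_fin => /predU1P[->|->].
  by rewrite ltxx subrr.
by rewrite EFinB.
Qed.

Lemma itvoc_integral_bounds f a b x y :
  {in `[a, b] &, {homo f : u v / u <= v}} -> 0 <= f a ->
  a <= x -> x <= y -> y <= b ->
  ((f x * (y - x))%:E <= \int[lebesgue_measure]_(u in `]x, y]) (f u)%:E
     <= (f y * (y - x))%:E)%E.
Proof.
move=> fnd fa ax xy yb.
have abP u : a <= u -> u <= b -> u \in `[a, b] by rewrite in_itv/= => -> ->.
have xb := le_trans xy yb; have ay := le_trans ax xy.
have f0 u : a <= u -> u <= b -> 0 <= f u.
  by move=> au ub; rewrite (le_trans fa)// fnd// abP// ?(le_trans au).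
have mf : measurable_fun `]x, y] f.
  apply: (measurable_funS _ _ (monotone_measurable_fun fnd)) => //.
  by move=> u/=; rewrite !in_itv/= => /andP[/ltW/(le_trans ax)-> /le_trans->].
rewrite !EFinM -lebesgue_measure_itvoc//; apply/andP; split.
  apply: ge0_integral_cst_le => // u/=; rewrite in_itv/= => /andP[xu uy].
  by rewrite f0// fnd// ?abP// ?(ltW xu)// ?(le_trans ax (ltW xu))// (le_trans uy).
apply: ge0_integral_le_cst => // u/=; rewrite in_itv/= => /andP[xu uy].
have au := le_trans ax (ltW xu); have ub := le_trans uy yb.
by rewrite f0// fnd// abP.
Qed.

(** The increments over [[x, y]] of [G] and of the integral of [f] both lie between [f x * (y - x)]
    and [f y * (y - x)], so their difference satisfies the hypothesis of
    [eq_of_slope_oscillation]. *)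
Lemma integral_of_slopes f G a b : a <= b ->
  {in `[a, b] &, {homo f : u v / u <= v}} -> 0 <= f a ->
  (forall x y, a <= x -> x <= y -> y <= b ->
    f x * (y - x) <= G y - G x <= f y * (y - x)) ->
  (\int[lebesgue_measure]_(u in `]a, b]) (f u)%:E = (G b - G a)%:E)%E.
Proof.
move=> ab fnd fa Gf.
pose I x y := (\int[lebesgue_measure]_(u in `]x, y]) (f u)%:E)%E.
have If x y : a <= x -> x <= y -> y <= b ->
    ((f x * (y - x))%:E <= I x y <= (f y * (y - x))%:E)%E.
  exact: itvoc_integral_bounds.
have Ifin x y : a <= x -> x <= y -> y <= b -> I x y \is a fin_num.
  move=> ax xy yb; have /andP[lI Iu] := If _ _ ax xy yb.
  by rewrite fin_numElt (lt_le_trans (ltNyr _) lI) (le_lt_trans Iu (ltry _)).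
have ID x y : a <= x -> x <= y -> y <= b -> I a y = (I a x + I x y)%E.
  move=> ax xy yb; rewrite /I -ge0_integral_setU//=.
  - congr integral; apply/seteqP; split => u/=; rewrite !in_itv/=.
      by move=> /andP[-> ->]; rewrite /= andbT; have [?|?] := leP u x; [left|right].
    move=> [] /andP[au ux]; first by rewrite au (le_trans ux).
    by rewrite (le_lt_trans ax).
  - apply/measurable_EFinP.
    apply: (measurable_funS _ _ (monotone_measurable_fun fnd)) => //.
    move=> u/= []; rewrite !in_itv/= => /andP[au ux].
      by rewrite ltW//= (le_trans ux)// (le_trans xy).
    by rewrite (le_trans ax (ltW au))//= (le_trans ux).
  - move=> u uxy; rewrite lee_fin (le_trans fa)//.
    have [au ub] : a <= u /\ u <= b.
      move: uxy => []/=; rewrite in_itv/= => /andP[au ux].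
        by rewrite ltW//= (le_trans ux)// (le_trans xy).
      by rewrite (le_trans ax (ltW au))//= (le_trans ux).
    by rewrite fnd// in_itv/= ?lexx ?au.
  - apply/disj_setPS => u/= []; rewrite !in_itv/= => /andP[_ ux] /andP[xu _].
    by move: ux; rewrite leNgt xu.
pose h x := G x - fine (I a x).
suff : h a = h b.
  rewrite /h {1}/I set_itvoc0 integral_set0/= subr0 => ->.
  by rewrite opprB addrC subrK fineK// Ifin.
apply: (@eq_of_slope_oscillation _ _ f) => // x y ax xy yb.
have -> : h y - h x = (G y - G x) - fine (I x y).
  rewrite /h (ID x y)// fineD ?Ifin// ?(le_trans xy)//; ring.
have /andP[G1 G2] := Gf _ _ ax xy yb.
have := If _ _ ax xy yb; rewrite -(fineK (Ifin _ _ ax xy yb)) !lee_fin => /andP[I1 I2].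
rewrite ler_norml; apply/andP; split; nra.
Qed.

(** [s] is controlled only on []a, b[]; extending it by zero makes it a nonnegative measurable
    density on the whole line. *)
Lemma integral_monotone_measure s a b :
  {in `]a, b[, forall u, 0 <= s u} ->
  {in `]a, b[ &, {homo s : u v / u <= v}} ->
  exists nu : {measure set (measurableTypeR R) -> \bar R},
    forall A : set R, measurable A -> A `<=` `]a, b[ ->
      nu A = (\int[lebesgue_measure]_(u in A) (s u)%:E)%E.
Proof.
move=> s0 snd.
have ms : measurable_fun setT ((EFin \o s) \_ `]a, b[).
  apply/(measurable_restrictT _ _).1 => //.
  by apply/measurable_EFinP; exact: monotone_measurable_fun.
have [|nu nuE] := density_measure lebesgue_measure ms.
  by move=> x; apply: erestrict_ge0 => u /= uab; rewrite lee_fin s0.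
exists nu => A mA Aab; rewrite nuE//; apply: eq_integral => u uA.
by rewrite patchT// inE; apply: Aab; rewrite inE in uA.
Qed.

End integrals.

(** * Distortion functions and densities of their measures *)

Section distortion.
Context {R : realType}.
Variables (D : R -> R) (Q : probability (measurableTypeR R) R).
Hypotheses (hD : distortion_function D) (hQ : corresponding_measure D Q).

Let D_nd : {in `[0, 1] &, {homo D : u v / u <= v}}.
Proof. by case: hD. Qed.

Lemma distortion_function1 : D 1 = 1.
Proof.
have [D01 _ _ _ supD] := hD.
have D1 : D 1 <= 1.
  by have := D01 1; rewrite !in_itv/= lexx ler01 => /(_ isT)/andP[].
apply/eqP; rewrite eq_le D1/= -[leLHS]supD ge_sup//.
  by exists (D 2^-1), 2^-1 => //=; rewrite in_itv/=; apply/andP; split; lra.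
move=> _ [u/= + <-]; rewrite in_itv/= => /andP[u0 u1].
by apply: D_nd; rewrite ?in_itv/= ?lexx ?ler01 ?(ltW u0) ?(ltW u1).
Qed.

Lemma corresponding_measure_itvoc u : 0 <= u -> u < 1 ->
  Q `]0, u]%classic = (D u)%:E.
Proof.
have [_ _ _ D0 _] := hD; have [_ QD] := hQ.
rewrite le_eqVlt => /predU1P[<- _|u0 u1]; first by rewrite set_itvoc0 measure0 D0.
by rewrite QD// in_itv/= u0.
Qed.

(** Open intervals stay inside []0, 1[] even for [u = 1], so the density remains applicable there;
    an inequality suffices for a supporting line. *)
Lemma corresponding_measure_itvoo_le u : 0 <= u -> u <= 1 ->
  (Q `]0%R, u[%classic <= (D u)%:E)%E.
Proof.
move=> u0; rewrite le_eqVlt => /predU1P[->|u1].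
  by rewrite distortion_function1; case: hQ => ->.
rewrite -corresponding_measure_itvoc//; apply: le_measure; rewrite ?inE//.
by apply: subset_itvl; rewrite bnd_simp.
Qed.

Lemma has_density_convex (s : R -> R) :
  spectral_function s -> has_density Q s ->
  convex_function (`[0, 1]%classic : set R) D.
Proof.
move=> [s0 snd _] Qs; apply: (@convex_of_support _ _ _ _ s) => c x.
move=> /andP[c0 c1] /andP[x0 x1].
have c01 : c \in `]0, 1[ by rewrite in_itv/= c0.
have ms := monotone_measurable_fun snd.
have Dc := corresponding_measure_itvoc (ltW c0) c1.
(* The right bound is left generic to cover both []0, c]] and []0, x[]. *)
have splitQ (u : R) (b : itv_bound R) : (BRight 0 <= BRight u)%O -> (BRight u <= b)%O ->
    Q [set` Interval (BRight 0) b] =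
    (Q `]0%R, u]%classic + Q [set` Interval (BRight u) b])%E.
  move=> u0 ub; rewrite (itv_bndbnd_setU u0 ub) measureU//.
  rewrite -subset0 => t/= []; rewrite itv_boundlr => /andP[_ tu].
  rewrite itv_boundlr => /andP[ut _].
  by move: ut; rewrite !bnd_simp ltNge => /negP; apply; move: tu; rewrite bnd_simp.
have [xc|cx|->] := ltgtP x c; last by rewrite !subrr mulr0.
- have Dx := corresponding_measure_itvoc x0 (lt_trans xc c1).
  have := splitQ x (BRight c); rewrite !bnd_simp x0 (ltW xc) => /(_ isT isT).
  rewrite [LHS]Dc [X in (X + _)%E]Dx.
  have sub : `]x, c] `<=` `]0, 1[.
    by move=> u/=; rewrite !in_itv/= => /andP[/(le_lt_trans x0)-> /le_lt_trans->].
  rewrite Qs//.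
  have := @ge0_integral_le_cst _ `]x, c]%classic s (s c).
  rewrite lebesgue_measure_itvoc ?(ltW xc)//.
  (* Left of [c] the density is at most [s c]. Infinite values of the integral contradict [e], whose
     left side is the real [D c]. *)
  case: (integral _ _ _) => [r||]; rewrite ?lee_fin => h e.
  + have {}h : r <= s c * (c - x).
      apply: h => //; first exact: measurable_funS ms.
      move=> u uxc; have u01 := sub _ uxc; rewrite s0//= snd//.
      by move: uxc; rewrite /= in_itv/= => /andP[].
    by case: e => ->; lra.
  + by [].
  + by [].
- have Dx := corresponding_measure_itvoo_le x0 x1.
  have := splitQ c (BLeft x); rewrite !bnd_simp cx (ltW c0) => /(_ isT isT) e.
  move: Dx; rewrite e [X in (X + _)%E]Dc.
  have sub : `]c, x[ `<=` `]0, 1[.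
    by move=> u/=; rewrite !in_itv/= => /andP[/(lt_trans c0)-> /lt_le_trans->].
  rewrite Qs// => Dx.
  (* Right of [c] the density is at least [s c]. *)
  suff : ((s c * (x - c))%:E <=
      \int[lebesgue_measure]_(u in `]c, x[) (s u)%:E)%E.
    move=> /(leeD2l (D c)%:E)/le_trans/(_ Dx).
    by rewrite -EFinD lee_fin -lerBrDl.
  have -> : (s c * (x - c))%:E =
      ((s c)%:E * lebesgue_measure (`]c, x[%classic : set R))%E.
    by rewrite lebesgue_measure_itv/= lte_fin cx -EFinB.
  apply: ge0_integral_cst_le => //; first exact: measurable_funS ms.
  move=> u ucx; have u01 := sub _ ucx; rewrite s0//= snd//.
  by move: ucx; rewrite /= in_itv/= => /andP[/ltW].
Qed.

Lemma convex_has_density : convex_function (`[0, 1]%classic : set R) D ->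
  exists2 s : R -> R, spectral_function s & has_density Q s.
Proof.
move=> cD; pose s := right_slope D 1.
have s0 u : 0 <= u -> u < 1 -> 0 <= s u by exact: right_slope_ge0.
have snd : {in `[0, 1[ &, {homo s : u v / u <= v}} by exact: right_slope_homo.
have [_ _ _ D0 _] := hD.
(* The integral is computed on [[0, u]] with [u < 1]: at [1] the right slope is the infimum of the
   empty set, and monotonicity may fail there. *)
have sD u : u \in `]0, 1[ ->
    (\int[lebesgue_measure]_(t in `]0%R, u]) (s t)%:E = (D u)%:E)%E.
  rewrite in_itv/= => /andP[u0 u1].
  rewrite (@integral_of_slopes _ s D) ?D0 ?subr0 ?(ltW u0)//.
  - by apply: sub_in2 snd => t; rewrite !in_itv/= => /andP[-> /le_lt_trans->].
  - exact: s0.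
  move=> x y x0; rewrite le_eqVlt => /predU1P[->|xy] yu.
    by rewrite !subrr !mulr0 lexx.
  have y1 := le_lt_trans yu u1.
  rewrite -ler_pdivlMr ?subr_gt0// -[X in _ && X]ler_pdivrMr ?subr_gt0//.
  apply/andP; split; first by apply: (right_slope_le D_nd) => //; exact: ltW.
  exact: (le_right_slope cD).
have s0' : {in `]0, 1[, forall u, 0 <= s u}.
  by move=> u; rewrite in_itv/= => /andP[/ltW/s0].
have snd' : {in `]0, 1[ &, {homo s : u v / u <= v}}.
  by apply: sub_in2 snd => t; rewrite !in_itv/= => /andP[/ltW->].
have [nu nuE] := integral_monotone_measure s0' snd'.
have [Q01 QD] := hQ.
have Qs : has_density Q s.
  move=> B mB B01; rewrite -nuE//; apply: (measure_itvoo_unique _ _ mB B01).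
    by rewrite [ltLHS]Q01 ltry.
  move=> u u01; rewrite [LHS]QD// nuE ?sD//.
  by move=> t/=; move: u01; rewrite !in_itv/= => /andP[_ u1] /andP[-> /le_lt_trans->].
(* The total integral of [s] is the mass that [Q] gives to []0, 1[]. *)
by exists s => //; split => //; rewrite -Qs.
Qed.

Lemma density_ae_derive (s : R -> R) :
  spectral_function s -> has_density Q s ->
  {ae lebesgue_measure, forall u : R, u \in `]0, 1[ ->
    derivable D u 1 /\ s u = derive1 D u}.
Proof.
move=> [s0 snd s1] Qs; have [_ QD] := hQ.
have ints : lebesgue_measure.-integrable `]0%R, 1%R[%classic (EFin \o s).
  apply/integrableP; split.
    by apply/measurable_EFinP; exact: monotone_measurable_fun.
  suff -> : (\int[lebesgue_measure]_(x in `]0%R, 1%R[) `|(EFin \o s) x| = 1)%E.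
    exact: ltry.
  rewrite -s1; apply: eq_integral => u u01.
  by rewrite gee0_abs// lee_fin s0//; rewrite inE in u01.
(* Extended by zero, [s] is integrable on the line, and its primitive from [-oo] coincides with [D]
   on []0, 1[]. *)
pose f : R -> R := s \_ `]0, 1[.
have intf : lebesgue_measure.-integrable setT (EFin \o f).
  by rewrite -restrict_EFin; apply: (iffLR (integrable_mkcond _ _)) ints.
have intfy y : lebesgue_measure.-integrable `]-oo, y] (EFin \o f).
  by apply: integrableS intf.
pose F x := \int[lebesgue_measure]_(t in `]-oo, x]) f t.
have : {ae lebesgue_measure, forall x, derivable F x 1 /\ derive1 F x = f x}.
  by apply: FTC1Ny => //; exact: integrable_locally_restrict.
have FD u : u \in `]0, 1[ -> F u = D u.
  move=> u01; rewrite /F /Rintegral.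
  transitivity (fine (\int[lebesgue_measure]_(x in `]-oo, u]) ((EFin \o s) \_ `]0%R, 1%R[) x)).
    by rewrite restrict_EFin.
  have -> : D u = fine (D u)%:E by [].
  rewrite -integral_mkcondr -QD// Qs//; last first.
    by move=> t/=; move: u01; rewrite !in_itv/= => /andP[_ u1] /andP[-> /le_lt_trans->].
  congr (fine (integral _ _ _)); apply/seteqP; split => t/=; rewrite !in_itv/=.
    by move=> [-> /andP[->]].
  by move: u01; rewrite in_itv/= => /andP[_ u1] /andP[-> tu]; rewrite tu (le_lt_trans tu).
apply: filterS; first exact: (ae_filter_ringOfSetsType lebesgue_measure).
move=> u/= [dF F'u] u01.
(* As []0, 1[] is open, [F] and [D] agree near [u], so derivability and the derivative pass from [F]
   to [D]. *)
have FDu : \near u, F u = D u.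
  by apply: filterS (near_in_itvoo u01) => t; exact: FD.
split; first exact: near_eq_derivable FDu dF.
rewrite derive1E -(near_eq_derive _ FDu) -derive1E F'u /f patchT//.
by rewrite inE.
Qed.

End distortion.

Theorem theorem4p2 (R : realType) (d : measure_display)
    (T : measurableType d) (P : probability T R)
    (D : R -> R) (Q : probability (measurableTypeR R) R)
    (hD : distortion_function D) (hQ : corresponding_measure D Q) :
  [/\ convex_function (`[0, 1]%classic : set R) D <->
        (exists2 s : R -> R, spectral_function s & has_density Q s),
      (exists2 s : R -> R, spectral_function s & has_density Q s) <->
        spectral_risk_measure (quantile_risk_measure P Q) &
      convex_function (`[0, 1]%classic : set R) D ->
        forall s : R -> R, spectral_function s -> has_density Q s ->
        {ae lebesgue_measure, forall u : R, u \in `]0, 1[ ->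
          derivable D u 1 /\ s u = derive1 D u}].
Proof.
split.
- split; first exact: convex_has_density.
  by move=> [s]; exact: has_density_convex.
- by split => [|[]].
- by move=> _ s; exact: density_ae_derive.
Qed.
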